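(* Let $T$ be a continuous t-norm, $A=[a_{ij}]\in[0,1]^{n\times m}$ and $b=[b_i]\in[0,1]^{n\times 1}$, and let $\Delta=\inf_{c\in\mathcal C}\Vert b-c\Vert$ be the Chebyshev distance associated to the second member $b$ of the system $A\,\Box_T^{\max}\,x=b$. Let $\mathcal C_b=\{c\in\mathcal C\mid\Vert b-c\Vert=\Delta\}$ be the set of Chebyshev approximations of $b$. Then $F(\overline b(\Delta))\in\mathcal C_b$, and $F(\overline b(\Delta))$ is the greatest Chebyshev approximation of $b$, i.e. the greatest element of $\mathcal C_b$ for the componentwise order.
   Context: A t-norm is a map $T:[0,1]\times[0,1]\to[0,1]$ that is commutative, associative, increasing (in the wide sense) in the second variable and satisfies $T(x,1)=x$. Its residual implicator is $\mathcal I_T(x,y)=\sup\{z\in[0,1]\mid T(x,z)\le y\}$ for $x,y\in[0,1]$. $n,m\ge1$ are integers. For $c=[c_i]\in[0,1]^{n\times1}$, the system $A\,\Box_T^{\max}\,x=c$ is: find $x=[x_j]\in[0,1]^{m\times1}$ with $\max_{1\le j\le m}T(a_{ij},x_j)=c_i$ for all $i\in\{1,\dots,n\}$; it is consistent if such an $x$ exists. $\mathcal C=\{c\in[0,1]^{n\times1}\mid A\,\Box_T^{\max}\,x=c\text{ is consistent}\}$. $\Vert b-c\Vert=\max_{1\le i\le n}|b_i-c_i|$. The map $F:[0,1]^{n\times1}\to[0,1]^{n\times1}$ (depending on $A$ and $T$) is defined by $$F(c)_i=\max_{1\le j\le m}T\big(a_{ij},\min_{1\le k\le n}\mathcal I_T(a_{kj},c_k)\big),\qquad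 1\le i\le n.$$ For $\delta\in[0,1]$, $\overline b(\delta)=[\min(b_i+\delta,1)]_{1\le i\le n}$. *)

(* Defs.v *)
From mathcomp Require Import all_boot all_order all_algebra.
From mathcomp Require Import all_classical all_reals all_analysis.

Set Implicit Arguments.
Unset Strict Implicit.
Unset Printing Implicit Defensive.

Import Order.TTheory GRing.Theory Num.Theory.
Import numFieldNormedType.Exports.

Local Open Scope classical_set_scope.
Local Open Scope ring_scope.

(* An operation on [0,1] is represented by T : R -> R -> R, of which only the
   restriction to [0,1] x [0,1] is constrained and used. *)
Record is_tnorm (R : realType) (T : R -> R -> R) : Prop := IsTnorm {
  tnorm_itv : forall x y, 0 <= x <= 1 -> 0 <= y <= 1 -> 0 <= T x y <= 1;
  tnormC : forall x y, 0 <= x <= 1 -> 0 <= y <= 1 -> T x y = T y x;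
  tnormA : forall x y z, 0 <= x <= 1 -> 0 <= y <= 1 -> 0 <= z <= 1 ->
    T x (T y z) = T (T x y) z;
  tnorm_le : forall x y z, 0 <= x <= 1 -> 0 <= y <= 1 -> 0 <= z <= 1 ->
    y <= z -> T x y <= T x z;
  tnorm1 : forall x, 0 <= x <= 1 -> T x 1 = x }.

(* Joint continuity on the unit square, for the subspace topology. *)
Definition tnorm_continuous (R : realType) (T : R -> R -> R) : Prop :=
  {within `[0, 1]%classic `*` `[0, 1]%classic,
    continuous (fun p : R * R => T p.1 p.2)}.

Definition residual (R : realType) (T : R -> R -> R) (x y : R) : R :=
  sup [set z : R | 0 <= z <= 1 /\ T x z <= y].

Definition unit_entries (R : realType) (n m : nat) (M : 'M[R]_(n, m)) : Prop :=
  forall i j, 0 <= M i j <= 1.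

(* The default values 0 of max and 1 of min are neutral on [0,1], hence
   irrelevant as soon as the index range is nonempty. *)
Definition maxT_prod (R : realType) (T : R -> R -> R) (n m : nat)
    (A : 'M[R]_(n, m)) (x : 'cV[R]_m) : 'cV[R]_n :=
  \col_(i < n) \big[Num.max/0]_(j < m) T (A i j) (x j 0).

Definition consistent_members (R : realType) (T : R -> R -> R) (n m : nat)
    (A : 'M[R]_(n, m)) : set 'cV[R]_n :=
  [set c | unit_entries c /\
    exists x : 'cV[R]_m, unit_entries x /\ maxT_prod T A x = c].

Definition F_map (R : realType) (T : R -> R -> R) (n m : nat)
    (A : 'M[R]_(n, m)) (c : 'cV[R]_n) : 'cV[R]_n :=
  \col_(i < n) \big[Num.max/0]_(j < m)
    T (A i j) (\big[Num.min/1]_(k < n) residual T (A k j) (c k 0)).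

Definition upper_shift (R : realType) (n : nat) (b : 'cV[R]_n) (delta : R) :
    'cV[R]_n :=
  \col_(i < n) Num.min (b i 0 + delta) 1.

(* The norm of MathComp-Analysis on matrices is the maximum of the absolute
   values of the entries. *)
Definition chebyshev_dist (R : realType) (T : R -> R -> R) (n m : nat)
    (A : 'M[R]_(n, m)) (b : 'cV[R]_n) : R :=
  inf [set `|b - c| | c in consistent_members T A].

Definition chebyshev_approx (R : realType) (T : R -> R -> R) (n m : nat)
    (A : 'M[R]_(n, m)) (b : 'cV[R]_n) : set 'cV[R]_n :=
  [set c | consistent_members T A c /\ `|b - c| = chebyshev_dist T A b].

(* Main.v *)
(** By continuity of [T], the supremum defining the residual implicator is
    attained, so [F c <= c], while every consistent [c <= d] satisfies
    [c <= F d]. The set of consistent members is the image of the compact cube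
    under a continuous map, so the infimum defining the distance [delta] is
    attained. Any [c] attaining it lies below [upper_shift b delta], hence below
    [F (upper_shift b delta)], which is itself below [upper_shift b delta]; being
    squeezed between [b - delta] and [b + delta], this consistent member is a
    Chebyshev approximation above all the others. *)
Require Import Defs.
From mathcomp Require Import all_boot all_order all_algebra.
From mathcomp Require Import all_classical all_reals all_analysis.

Set Implicit Arguments.
Unset Strict Implicit.
Unset Printing Implicit Defensive.

Import Order.TTheory GRing.Theory Num.Theory.
Import numFieldNormedType.Exports.

Local Open Scope classical_set_scope.
Local Open Scope ring_scope.

Lemma cV_dist_leP (R : realType) (n : nat) (b c : 'cV[R]_n) (e : R) :
  0 <= e -> (`|b - c| <= e) <-> (forall i, `|b i 0 - c i 0| <= e).
Proof.
move=> e0; rewrite {1}/Num.Def.normr /= mx_normrE.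
have E i : (b - c) i 0 = b i 0 - c i 0 by rewrite !mxE.
split; first by move=> /bigmax_leP[_ H] i; rewrite -E; exact: (H (i, 0)).
by move=> H; apply/bigmax_leP; split => // -[i j] _; rewrite ord1 E; exact: H.
Qed.

(** A matrix neighbourhood contains a product of neighbourhoods of the finitely many entries, so
    entrywise continuity suffices. *)
Lemma within_continuous_mx (R : realType) (U : topologicalType) (D : set U)
    (n m : nat) (f : U -> 'M[R]_(n, m)) :
  (forall i j, {within D, continuous (fun u => f u i j)}) ->
  {within D, continuous f}.
Proof.
move=> fc x; move=> B [P Px PB].
apply: filterS (_ : \forall u \near x, forall i j, P i j (f u i j)).
  by move=> u Pu; exact: PB.
by do 2!(apply: filter_forall => ?); exact/fc/Px.
Qed.

Section tnorm.
Variables (R : realType) (T : R -> R -> R) (hT : is_tnorm T).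

Lemma tnorm_ge0 x y : 0 <= x <= 1 -> 0 <= y <= 1 -> 0 <= T x y.
Proof. by move=> hx hy; have /andP[] := tnorm_itv hT hx hy. Qed.

Lemma tnorm_le1 x y : 0 <= x <= 1 -> 0 <= y <= 1 -> T x y <= 1.
Proof. by move=> hx hy; have /andP[] := tnorm_itv hT hx hy. Qed.

(** Since [T x 0 = T 0 x <= T 0 1 = 0]. This puts [0] in the set whose supremum is [residual T x y]
    when [0 <= y], so that set is nonempty. *)
Lemma tnorm0 x : 0 <= x <= 1 -> T x 0 = 0.
Proof.
move=> hx; have h0 : 0 <= (0 : R) <= 1 by rewrite lexx ler01.
have h1 : 0 <= (1 : R) <= 1 by rewrite lexx ler01.
apply/eqP; rewrite eq_le tnorm_ge0 // andbT (tnormC hT) //.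
rewrite -[leRHS](tnorm1 hT h0); apply: (tnorm_le hT) => //.
by case/andP: hx.
Qed.

Lemma residual_ge x y z : 0 <= z <= 1 -> T x z <= y -> z <= residual T x y.
Proof.
move=> hz Tz; apply: ub_le_sup; last by split.
by exists 1 => t /= [] /andP[].
Qed.

Lemma residual_itv x y : 0 <= x <= 1 -> 0 <= y -> 0 <= residual T x y <= 1.
Proof.
move=> hx y0; rewrite residual_ge ?tnorm0 ?lexx ?ler01 //=.
apply: ge_sup; last by move=> t /= [] /andP[].
by exists 0; split; rewrite ?tnorm0 ?lexx ?ler01.
Qed.

Lemma maxT_prod_itv n m (A : 'M[R]_(n, m)) (x : 'cV[R]_m) :
  unit_entries A -> unit_entries x -> unit_entries (maxT_prod T A x).
Proof.
move=> hA hx i j; rewrite mxE bigmax_ge_id /=.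
by apply: bigmax_le => // k _; exact: tnorm_le1.
Qed.

(** For continuous [T] and entries in the unit interval, this is the greatest [x] in the cube with
    [maxT_prod T A x <= c]. *)
Definition min_residual n m (A : 'M[R]_(n, m)) (c : 'cV[R]_n) : 'cV[R]_m :=
  \col_j \big[Num.min/1]_(k < n) residual T (A k j) (c k 0).

Lemma F_mapE n m (A : 'M[R]_(n, m)) c :
  F_map T A c = maxT_prod T A (min_residual A c).
Proof.
apply/colP => i; rewrite !mxE; apply: eq_bigr => j _.
by rewrite mxE.
Qed.

Lemma min_residual_itv n m (A : 'M[R]_(n, m)) c :
  unit_entries A -> unit_entries c -> unit_entries (min_residual A c).
Proof.
move=> hA hc j j0; rewrite mxE bigmin_le_id andbT.
apply: le_bigmin => // k _.
have /andP[c0 _] := hc k 0.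
by have /andP[] := residual_itv (hA k j) c0.
Qed.

Lemma F_map_consistent n m (A : 'M[R]_(n, m)) c :
  unit_entries A -> unit_entries c -> consistent_members T A (F_map T A c).
Proof.
move=> hA hc; rewrite F_mapE; have hx := min_residual_itv hA hc.
by split; [exact: maxT_prod_itv|exists (min_residual A c)].
Qed.

(** If [x] solves the system for [c], then [T (A k j) (x j 0) <= c k 0 <= d k 0] for all [k], so
    [x <= min_residual A d]; monotonicity of [T] concludes. *)
Lemma consistent_le_F_map n m (A : 'M[R]_(n, m)) c d :
  unit_entries A -> unit_entries d -> consistent_members T A c ->
  (forall i, c i 0 <= d i 0) -> forall i, c i 0 <= F_map T A d i 0.
Proof.
move=> hA hd [_ [x [hx <-]]] cd i; rewrite F_mapE !mxE.
apply: le_bigmax2 => j _; apply: (tnorm_le hT) => //.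
  exact: min_residual_itv.
rewrite mxE; apply: le_bigmin; first by case/andP: (hx j 0).
move=> k _; apply: residual_ge => //; apply: le_trans (cd k).
by rewrite mxE; exact: (le_bigmax _ (fun j => T (A k j) (x j 0))).
Qed.

Hypothesis hTc : tnorm_continuous T.

(** [T] is continuous only relative to the unit square, so [f] and [g] have to map [D] into the unit
    interval. *)
Lemma within_continuous_tnorm (U : topologicalType) (D : set U)
    (f g : U -> R) :
  (forall u, D u -> 0 <= f u <= 1) -> (forall u, D u -> 0 <= g u <= 1) ->
  {within D, continuous f} -> {within D, continuous g} ->
  {within D, continuous (fun u => T (f u) (g u))}.
Proof.
move=> hf hg /subspace_continuousP fc /subspace_continuousP gc.
apply/subspace_continuousP => u Du.
have sq v : D v -> (`[0, 1]%classic `*` `[0, 1]%classic)%classic (f v, g v).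
  by move=> Dv; split; rewrite /= in_itv /=; [exact: hf|exact: hg].
have /subspace_continuousP/(_ (f u, g u) (sq u Du)) Tc := hTc.
apply: (cvg_comp (fun v => (f v, g v)) (fun p : R * R => T p.1 p.2) _ Tc).
move=> B; rewrite /within /= => nB.
(* Membership in [B] is known only for pairs inside the square; on [D] this condition is discharged
   by [sq]. *)
have : within D (nbhs u)
    [set v | (`[0, 1] `*` `[0, 1]) (f v, g v) -> B (f v, g v)].
  exact: (@cvg_pair _ _ _ (within D (nbhs u)) (nbhs (f u)) (nbhs (g u))
    _ _ _ f g (fc u Du) (gc u Du) _ nB).
by apply: (@filterS _ (nbhs u)) => v BD Dv; exact: BD Dv (sq v Dv).
Qed.

(** Otherwise, by continuity, [T x z > y] for all [z] of the unit interval near the supremum, yet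
    points with [T x z <= y] lie arbitrarily close to it. *)
Lemma tnorm_residual x y : 0 <= x <= 1 -> 0 <= y -> T x (residual T x y) <= y.
Proof.
move=> hx y0; rewrite leNgt; apply/negP => yT.
have hr := residual_itv hx y0.
have : {within `[0, 1]%classic, continuous (fun z : R => T x z)}.
  apply: within_continuous_tnorm => //.
  - by apply: continuous_subspaceT => u; exact: cst_continuous.
  - apply: continuous_subspaceT => u; exact: cvg_id.
move=> /subspace_continuousP/(_ (residual T x y)).
rewrite /= in_itv /= => /(_ hr)/(_ _ (lt_nbhsr yT)).
rewrite nbhs_simpl /= => /closure_sup[].
- by exists 0; split; rewrite ?tnorm0 ?lexx ?ler01.
- by exists 1 => t /= [] /andP[].
move=> z [[hz Tz]] /=; rewrite in_itv /= => /(_ hz).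
by rewrite ltNge Tz.
Qed.

(** In row [i], bound the minimum over [k] by its term [k = i] and apply [tnorm_residual]. *)
Lemma F_map_le n m (A : 'M[R]_(n, m)) c :
  unit_entries A -> unit_entries c -> forall i, F_map T A c i 0 <= c i 0.
Proof.
move=> hA hc i; rewrite F_mapE mxE; have /andP[c0 _] := hc i 0.
apply: bigmax_le => // j _; apply: le_trans (tnorm_residual (hA i j) c0).
apply: (tnorm_le hT) => //; first exact: min_residual_itv.
  exact: residual_itv.
by rewrite mxE; exact: (bigmin_le _ _ (fun k => residual T (A k j) (c k 0))).
Qed.

Lemma chebyshev_dist_attained n m (A : 'M[R]_(n, m)) (b : 'cV[R]_n) :
  unit_entries A -> exists c, chebyshev_approx T A b c.
Proof.
move=> hA.
(* The cube consists of row vectors, as in [rV_compact] and [EVT_min_rV], while solutions are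
   columns; hence the transpositions. *)
pose K := [set v : 'rV[R]_m | forall j, `[0, 1]%classic (v 0 j)]%classic.
have KP v : K v <-> unit_entries v^T.
  split=> [Kv i j|hv j]; last by rewrite /= in_itv /=; have := hv j 0; rewrite mxE.
  by rewrite mxE ord1; have := Kv i; rewrite /= in_itv.
have Kc : compact K.
  apply: (@rV_compact R m (fun=> `[0, 1]%classic)) => j.
  exact: segment_compact.
have K0 : (K !=set0)%classic.
  by exists 0 => j; rewrite /= mxE in_itv /= lexx ler01.
have fc : {within K, continuous (fun v : 'rV[R]_m => `|b - maxT_prod T A v^T|)}.
  apply: (@within_continuous_comp _ _ _ K
    (fun v => maxT_prod T A v^T) (fun M : 'cV[R]_n => `|b - M|)).
    move=> M _; apply: (@continuous_comp _ _ _ (fun M : 'cV[R]_n => b - M)).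
      apply: (@cvgB _ _ _ (nbhs M) _ (cst b) id b M); first exact: cvg_cst.
      exact: cvg_id.
    exact: norm_continuous.
  apply: within_continuous_mx => i k.
  under eq_fun do rewrite mxE.
  apply: continuous_big => [|j _]; first exact: max_continuous.
  apply: within_continuous_tnorm.
  - by move=> u _; exact: hA.
  - by move=> u /KP; exact.
  - by apply: continuous_subspaceT => u; exact: cst_continuous.
  - apply: continuous_subspaceT => v; under eq_fun do rewrite mxE.
    exact: coord_continuous.
have [v /set_mem Kv vmin] := EVT_min_rV K0 Kc fc.
have Cv w : K w -> consistent_members T A (maxT_prod T A w^T).
  by move=> /KP hw; split; [exact: maxT_prod_itv|exists w^T].
exists (maxT_prod T A v^T); split; first exact: Cv.
apply/eqP; rewrite eq_le; apply/andP; split.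
  apply: lb_le_inf; first by eexists; exists (maxT_prod T A v^T); first exact: Cv.
  (* Every consistent member is the image of a point of the cube, so the minimum over [K] bounds all
     the distances from below. *)
  move=> _ [_ [_ [x [hx <-]]] <-]; rewrite -[x]trmxK; apply: vmin.
  by apply/mem_set/KP; rewrite trmxK.
apply: ge_inf; last by exists (maxT_prod T A v^T); first exact: Cv.
by exists 0 => _ [c _ <-].
Qed.

End tnorm.

Theorem corollary1 (R : realType) (T : R -> R -> R) (n m : nat)
    (A : 'M[R]_(n, m)) (b : 'cV[R]_n)
    (hn : (1 <= n)%N) (hm : (1 <= m)%N)
    (hT : is_tnorm T) (hTc : tnorm_continuous T)
    (hA : unit_entries A) (hb : unit_entries b) :
  chebyshev_approx T A b
    (F_map T A (upper_shift b (chebyshev_dist T A b))) /\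
  (forall c : 'cV[R]_n, chebyshev_approx T A b c ->
    forall i : 'I_n,
      c i 0 <= F_map T A (upper_shift b (chebyshev_dist T A b)) i 0).
Proof.
have [c0 [Cc0 dc0]] := chebyshev_dist_attained hT hTc b hA.
set d := chebyshev_dist T A b in dc0 *; set B := upper_shift b d.
have d0 : 0 <= d by rewrite -dc0.
have hB : unit_entries B.
  move=> i j; have /andP[bi0 _] := hb i 0.
  by rewrite mxE le_min ler01 addr_ge0 //= ge_min lexx orbT.
have approx_le c : chebyshev_approx T A b c -> forall i, c i 0 <= F_map T A B i 0.
  move=> [Cc dc]; apply: consistent_le_F_map => // i.
  have /cV_dist_leP - /(_ d0) /(_ i) : `|b - c| <= d by rewrite dc.
  (* The distance gives [c <= b + d]; the truncation at [1] is met because [c] has entries in the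
     unit interval. *)
  rewrite mxE le_min ler_distlC => /andP[_ ->] /=.
  by have [/(_ i 0)/andP[]] := Cc.
split => //; split; first exact: F_map_consistent.
apply/eqP; rewrite eq_le; apply/andP; split; last first.
  apply: ge_inf; first by exists 0 => _ [c _ <-].
  by exists (F_map T A B) => //; exact: F_map_consistent.
apply/cV_dist_leP => // i; rewrite ler_distlC; apply/andP; split.
  (* The attained minimum [c0] supplies the lower bound: [b - d <= c0 <= F_map T A B]. *)
  apply: le_trans (approx_le c0 (conj Cc0 dc0) i).
  have /cV_dist_leP - /(_ d0) /(_ i) : `|b - c0| <= d by rewrite dc0.
  by rewrite ler_distlC => /andP[].
by apply: le_trans (F_map_le hT hTc hA hB i) _; rewrite mxE ge_min lexx.
Qed.
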